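(* Let $\mathfrak M$ be a Hilbert space and let the mappings $\Phi_+:\widetilde{\mathcal S}(\mathfrak M)\to\widetilde{\mathcal S}(\mathfrak M)$ and $\Phi_-:\widetilde{\mathcal S}^{(-1)}(\mathfrak M)\to\widetilde{\mathcal S}^{(-1)}(\mathfrak M)$ be defined by $$(\Phi_+\mathcal Q)(\lambda)=-\frac{\mathcal Q(\lambda)^{-1}}{\lambda},\qquad(\Phi_-\mathcal R)(\lambda)=-\lambda\,\mathcal R(\lambda)^{-1},\qquad\lambda\in\mathbb C\setminus\mathbb R_+.$$ Then, with $\lambda\in\mathbb C\setminus\mathbb R_+$: (1) the mapping $\Phi_+$ has a unique fixed point $$\mathcal Q_0(\lambda)=\frac{i}{\sqrt\lambda}\,I_{\mathfrak M},\qquad\mathcal Q_0(-1)=I_{\mathfrak M};$$ (2) the mapping $\Phi_-$ has a unique fixed point $$\mathcal R_0(\lambda)=i\sqrt\lambda\,I_{\mathfrak M},\qquad\mathcal R_0(-1)=-I_{\mathfrak M}.$$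
   Context: All Hilbert spaces are complex and separable; $\mathbb R_+=[0,+\infty)$, $\mathbb C_\pm$ are the open upper/lower half-planes; $\mathbf B(\mathfrak M)$ is the algebra of bounded everywhere defined operators. The square root is the holomorphic branch on $\mathbb C\setminus\mathbb R_+$ with $\sqrt{-1}=i$ (as determined by the normalizations at $\lambda=-1$). A linear relation in $\mathfrak M$ is a linear subspace $H$ of $\mathfrak M\times\mathfrak M$, with elements $\{f,f'\}$; operators are identified with graphs. $H^{-1}=\{\{f',f\}:\{f,f'\}\in H\}$, $cH=\{\{f,cf'\}\}$, $H+cI=\{\{f,f'+cf\}\}$. Adjoint: $H^*=\{\{k,k'\}:(h',k)=(h,k')\ \forall\{h,h'\}\in H\}$; $H\ge0$ if $(f',f)\ge0$ on $H$; $H\le0$ if $-H\ge0$; $H$ is dissipative (accumulative) if $\operatorname{Im}(f',f)\ge0$ ($\le0$) on $H$; maximal means having no proper extension with the same property. A family of linear relations $\mathcal M(\lambda)$, $\lambda\in\mathbb C\setminus\mathbb R$, in $\mathfrak M$ is a Nevanlinna family if: (i) $\mathcal M(\lambda)$ is maximal dissipative for $\lambda\in\mathbb C_+$ (resp. maximal accumulative for $\lambda\in\mathbb C_-$); (ii) $\mathcal M(\lambda)^*=\mathcal M(\bar\lambda)$; (iii) for some (hence all) $\mu\in\mathbb C_+$ ($\mathbb C_-$) the family $(\mathcal M(\lambda)+\mu)^{-1}\in\mathbf B(\mathfrak M)$ is holomorphic for $\lambda\in\mathbb C_+$ ($\mathbb C_-$). A family $\mathcal M(\lambda)$, $\lambda\in\mathbb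 C\setminus\mathbb R_+$, is a Stieltjes family, class $\widetilde{\mathcal S}(\mathfrak M)$ (respectively inverse Stieltjes family, class $\widetilde{\mathcal S}^{(-1)}(\mathfrak M)$) if it is a Nevanlinna family and, moreover, (i) $\mathcal M(x)\ge0$ for all $x<0$ (respectively $\mathcal M(x)\le0$ for all $x<0$), (ii) for some (hence all) $\mu\in\mathbb C_+$ ($\mathbb C_-$) the operator family $(\mathcal M(\lambda)+\mu)^{-1}\in\mathbf B(\mathfrak M)$, $\lambda\in\mathbb C_+$ ($\mathbb C_-$), admits an analytic continuation to $(-\infty,0)$. The mappings $\Phi_\pm$ are well defined between the indicated classes. *)

(* Defs.v *)
From HB Require Import structures.
From mathcomp Require Import all_boot all_order all_algebra.
From mathcomp Require Import sesquilinear complex.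
From mathcomp Require Import all_classical all_reals all_analysis.

Set Implicit Arguments.
Unset Strict Implicit.
Unset Printing Implicit Defensive.

Import Order.TTheory GRing.Theory Num.Theory Num.Def.
Import numFieldNormedType.Exports.

Local Open Scope ring_scope.
Local Open Scope classical_set_scope.

(* The field of complex numbers is [R[i]] for a [R : realType].  In its order,
   [0 <= z] means that [z] is real and nonnegative, and [z < 0] that [z] is real
   and negative.  Its topology is carried by the alias [R[i]^o]. *)

Section ComplexDomains.
Variable R : realType.

Definition upper_half : set R[i] := [set z | 0 < complex.Im z].
Definition lower_half : set R[i] := [set z | complex.Im z < 0].
Definition neg_axis : set R[i] := [set z | z < 0].
Definition cut_plane : set R[i] := [set z | ~~ (0 <= z)].

Definition is_sqrt_branch (sq : R[i] -> R[i]) : Prop :=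
  [/\ forall z, cut_plane z -> sq z ^+ 2 = z,
      forall z, cut_plane z -> derivable (sq : R[i]^o -> R[i]^o) z 1 &
      sq (-1) = 'i%C].

End ComplexDomains.

Section HilbertSpace.
Variables (R : realType) (V : completeNormedModType R[i]).

(* The inner product is linear in its first argument. *)
Definition is_hilbert_dot (dot : {dot V for conjC}) : Prop :=
  forall x : V, dot x x = `|x| ^+ 2.

Definition is_separable : Prop := exists2 D : set V, countable D & dense D.

End HilbertSpace.

Section LinearRelations.
Variables (R : realType) (V : completeNormedModType R[i]).
Variable dot : {dot V for conjC}.

Definition linear_relation (H : set (V * V)) : Prop := submod_closed (mem H).

Definition graph (T : V -> V) : set (V * V) := [set p | p.2 = T p.1].

Definition inv_rel (H : set (V * V)) : set (V * V) :=
  [set (p.2, p.1) | p in H].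

Definition scale_rel (c : R[i]) (H : set (V * V)) : set (V * V) :=
  [set (p.1, c *: p.2) | p in H].

Definition shift_rel (H : set (V * V)) (c : R[i]) : set (V * V) :=
  [set (p.1, p.2 + c *: p.1) | p in H].

Definition adj_rel (H : set (V * V)) : set (V * V) :=
  [set k | forall h, H h -> dot h.2 k.1 = dot h.1 k.2].

Definition nonneg_rel (H : set (V * V)) : Prop :=
  forall h, H h -> 0 <= dot h.2 h.1.

Definition nonpos_rel (H : set (V * V)) : Prop := nonneg_rel (scale_rel (-1) H).

Definition dissipative (H : set (V * V)) : Prop :=
  forall h, H h -> 0 <= complex.Im (dot h.2 h.1).

Definition accumulative (H : set (V * V)) : Prop :=
  forall h, H h -> complex.Im (dot h.2 h.1) <= 0.

Definition maximal_rel (P : set (V * V) -> Prop) (H : set (V * V)) : Prop :=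
  [/\ linear_relation H, P H &
      forall K, linear_relation K -> P K -> H `<=` K -> K = H].

Definition bounded_op (T : V -> V) : Prop :=
  exists c : R[i], forall x, `|T x| <= c * `|x|.

(* Complex differentiability in the operator norm: the difference quotients of
   [T] at [z] converge to [D] uniformly on the unit ball. *)
Definition holomorphic_op_on (U : set R[i]) (T : R[i] -> {linear V -> V}) :
    Prop :=
  forall z, U z -> exists2 D : {linear V -> V}, bounded_op D &
    forall eps : R[i], 0 < eps ->
      \forall h \near (0 : R[i]^o)^',
        forall x, `|h^-1 *: (T (z + h) x - T z x) - D x| <= eps * `|x|.

Definition holomorphic_resolvent (M : R[i] -> set (V * V)) (mu : R[i])
    (A : set R[i]) : Prop :=
  exists T : R[i] -> {linear V -> V},
    [/\ forall z, A z -> bounded_op (T z),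
        forall z, A z -> inv_rel (shift_rel (M z) mu) = graph (T z) &
        holomorphic_op_on A T].

Definition nevanlinna_family (M : R[i] -> set (V * V)) : Prop :=
  [/\ (forall z, upper_half z -> maximal_rel dissipative (M z)) /\
      (forall z, lower_half z -> maximal_rel accumulative (M z)),
      forall z, complex.Im z != 0 -> adj_rel (M z) = M (conjC z) &
      (exists2 mu, upper_half mu & holomorphic_resolvent M mu (@upper_half R)) /\
      (exists2 mu, lower_half mu & holomorphic_resolvent M mu (@lower_half R))].

(* The continuation is holomorphic on some open set containing [A] and the
   negative half-line.  The relations [M x], [x < 0], belong to the family, so
   the value of the continuation at [x] is the resolvent of [M x]. *)
Definition resolvent_continues (M : R[i] -> set (V * V)) (mu : R[i])
    (A : set R[i]) : Prop :=
  exists (U : set R[i]) (T : R[i] -> {linear V -> V}),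
    [/\ open (U : set R[i]^o), A `|` @neg_axis R `<=` U,
        forall z, U z -> bounded_op (T z),
        forall z, (A `|` @neg_axis R) z ->
          inv_rel (shift_rel (M z) mu) = graph (T z) &
        holomorphic_op_on U T].

Definition continues_to_neg_axis (M : R[i] -> set (V * V)) : Prop :=
  (exists2 mu, upper_half mu & resolvent_continues M mu (@upper_half R)) /\
  (exists2 mu, lower_half mu & resolvent_continues M mu (@lower_half R)).

(* Families over the cut plane are total functions of which only the values on
   [cut_plane] matter. *)
Definition stieltjes_family (M : R[i] -> set (V * V)) : Prop :=
  [/\ nevanlinna_family M,
      forall x, neg_axis x -> linear_relation (M x) /\ nonneg_rel (M x) &
      continues_to_neg_axis M].

Definition inv_stieltjes_family (M : R[i] -> set (V * V)) : Prop :=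
  [/\ nevanlinna_family M,
      forall x, neg_axis x -> linear_relation (M x) /\ nonpos_rel (M x) &
      continues_to_neg_axis M].

Definition Phi_plus (Q : R[i] -> set (V * V)) : R[i] -> set (V * V) :=
  fun z => scale_rel (- z^-1) (inv_rel (Q z)).

Definition Phi_minus (M : R[i] -> set (V * V)) : R[i] -> set (V * V) :=
  fun z => scale_rel (- z) (inv_rel (M z)).

Definition scalar_rel (c : R[i]) : set (V * V) := graph (fun x => c *: x).

Definition unique_fixed_point (F : (R[i] -> set (V * V)) -> Prop)
    (Phi : (R[i] -> set (V * V)) -> R[i] -> set (V * V))
    (M0 : R[i] -> set (V * V)) : Prop :=
  [/\ F M0,
      {in @cut_plane R, Phi M0 =1 M0} &
      forall M, F M -> {in @cut_plane R, Phi M =1 M} ->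
        {in @cut_plane R, M =1 M0}].

End LinearRelations.

Arguments scalar_rel [R] V c.

(* Main.v *)
Require Import Defs.
From HB Require Import structures.
From mathcomp Require Import all_boot all_order all_algebra.
From mathcomp Require Import sesquilinear complex.
From mathcomp Require Import all_classical all_reals all_analysis.
From mathcomp Require Import ring lra.

(* Both fixed points have the form [s(z) I] with [s(z)^2] the scalar of the
   mapping, and a fixed point [M] satisfies [M = s^2 M^-1] at every [z].  So
   [(f, f')] in [M] gives [(f', s^2 f)] in [M], hence [(d, - s d)] in [M] for
   [d = s f - f'].  For nonreal [z] the sign of [Im s] together with
   dissipativity (accumulativity) forces [d = 0]; for [z < 0] the sign of [s]
   together with that of [M z] does.  Thus [M] is contained in the graph of [s],
   and by maximality equals it: the argument is pointwise in [z] and needs no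
   identity theorem.  The signs of [s] come from [Im (sqrt z) > 0] on the cut
   plane. *)

Set Implicit Arguments.
Unset Strict Implicit.
Unset Printing Implicit Defensive.

Import Order.TTheory GRing.Theory Num.Theory Num.Def.
Import numFieldNormedType.Exports.

Local Open Scope ring_scope.
Local Open Scope classical_set_scope.

(** * Linear relations: scalar multiples of the identity and fixed points of scaled inversion *)

Section LinearRelations.
Variables (R : realType) (V : completeNormedModType R[i]).
Variable dot : {dot V for conjC}.
Implicit Types (H K M : set (V * V)) (c s mu : R[i]).

Lemma linear_relationP H : linear_relation H ->
  forall a u v, H u -> H v -> H (a *: u + v).
Proof.
by move=> [_ h] a u v Hu Hv; have := h a u v; rewrite !inE; exact.
Qed.

Lemma linear_graph (T : {linear V -> V}) : linear_relation (graph T).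
Proof.
split; first by rewrite inE /graph /= linear0.
move=> a u v; rewrite !inE /graph /= => -> ->.
by rewrite linearP.
Qed.

Lemma linear_scalar_rel s : linear_relation (scalar_rel V s).
Proof. exact: (linear_graph ( *:%R s : {linear V -> V})). Qed.

Lemma resolvent_scalar_rel s mu : s + mu != 0 ->
  inv_rel (shift_rel (scalar_rel V s) mu) = scalar_rel V (s + mu)^-1.
Proof.
move=> smu0; apply/seteqP; split=> [_ [_ [[f f'] + <-] <-]|[g f]] /=.
  by rewrite /scalar_rel /graph /= => ->; rewrite -scalerDl scalerK.
rewrite /scalar_rel /graph /= => ->.
exists ((s + mu)^-1 *: g, g) => //.
exists ((s + mu)^-1 *: g, s *: ((s + mu)^-1 *: g)) => //=.
by rewrite -scalerDl scalerKV.
Qed.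

Lemma Phi_scalar_rel s c : s != 0 -> c = s ^+ 2 ->
  scale_rel c (inv_rel (scalar_rel V s)) = scalar_rel V s.
Proof.
move=> s0 ->; apply/seteqP; split=> [_ [_ [[f f'] + <-] <-]|[g f]] /=.
  by rewrite /scalar_rel /graph /= => ->; rewrite expr2 scalerA.
rewrite /scalar_rel /graph /= => ->.
exists (g, s^-1 *: g); last by rewrite /= scalerA expr2 mulfK.
by exists (s^-1 *: g, g); rewrite //= scalerKV.
Qed.

Lemma dotZll a b (u : V) : dot (a *: u) (b *: u) = a * conjC b * dot u u.
Proof. by rewrite linearZl_LR linearZr_LR /= mulrA. Qed.

Lemma adj_scalar_rel s : adj_rel dot (scalar_rel V s) = scalar_rel V (conjC s).
Proof.
apply/seteqP; split=> [[k k'] hk|[k k']]; last first.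
  rewrite /scalar_rel /graph /= => -> [h _] /= ->.
  by rewrite linearZl_LR linearZr_LR /= conjCK.
rewrite /scalar_rel /graph /=; apply/eqP.
rewrite -subr_eq0 -(dnorm_eq0 dot) /=.
set d := k' - _.
(* Testing against the defect [d] itself gives [s * dot d k = dot d k'], that is [dot d d = 0]. *)
have := hk (d, s *: d) erefl; rewrite /= linearZl_LR /= => e.
by rewrite {2}/d linearBr /= linearZr_LR /= conjCK e subrr.
Qed.

Lemma dnorm_Im0 (u : V) : complex.Im (dot u u) = 0.
Proof. by have := dnorm_ge0 dot u; rewrite lecE => /andP[/eqP]. Qed.

Lemma dnorm_Re_gt0 (u : V) : u != 0 -> 0 < complex.Re (dot u u).
Proof. by rewrite -(dnorm_gt0 dot) ltcE => /andP[]. Qed.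

Lemma Im_dotZl a (u : V) :
  complex.Im (dot (a *: u) u) = complex.Im a * complex.Re (dot u u).
Proof.
rewrite linearZl_LR /=; have := dnorm_Im0 u.
by case: (dot u u) a => x y [a b] /= ->; rewrite mulr0 add0r.
Qed.

(** This drives maximality. An extension of the scalar relation that contains a pair off it also
    contains [(0, d)] with [d != 0]; adding suitable pairs of the scalar relation produces an
    imaginary part of sign opposite to [Im s]. *)
Lemma linear_ext_defect K s f f' : complex.Im s != 0 ->
  linear_relation K -> scalar_rel V s `<=` K -> K (f, f') ->
  exists2 h, K h & complex.Im (dot h.2 h.1) =
    - (4 * complex.Im s)^-1 * complex.Re (dot (f' - s *: f) (f' - s *: f)).
Proof.
move=> s0 lK sK Kf; set d := f' - s *: f.
have Kd : K (0, d).
  have := linear_relationP lK (-1) (sK (f, s *: f) erefl) Kf.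
  suff -> : -1 *: (f, s *: f) + (f, f') = (0, d) by [].
  by apply/pair_equal_spec; rewrite /= !scaleN1r addNr addrC.
(* The extremum of [Im (dot h.2 h.1)] over [h = (a d, (s a + 1) d)] with [a]
   imaginary. *)
pose a := (0 +i* (2 * complex.Im s)^-1)%C.
have := linear_relationP lK 1 (sK (a *: d, s *: (a *: d)) erefl) Kd.
rewrite scale1r => Ka; exists (a *: d, (s * a + 1) *: d).
  move: Ka; congr (K _); apply/pair_equal_spec.
  by rewrite /= addr0 scalerDl scale1r scalerA.
rewrite /= dotZll; move: (dot d d) (dnorm_Im0 d) => D.
by rewrite /a; clear -s0; case: D s s0 => x y [p q] /= q0 ->; field.
Qed.

(** The factor [Im s] in the condition on [P] absorbs the sign, so that dissipative and accumulative
    relations are treated together. *)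
Lemma maximal_scalar_rel (P : set (V * V) -> Prop) s : complex.Im s != 0 ->
  (forall K, P K <->
     forall h, K h -> 0 <= complex.Im s * complex.Im (dot h.2 h.1)) ->
  maximal_rel P (scalar_rel V s).
Proof.
move=> s0 PE; split; first exact: linear_scalar_rel.
  apply/PE => -[f f']; rewrite /scalar_rel /graph /= => ->.
  rewrite Im_dotZl mulrA mulr_ge0 -?expr2 ?sqr_ge0//.
  by have := dnorm_ge0 dot f; rewrite lecE => /andP[].
move=> K lK /PE PK sK; apply/seteqP; split=> // -[f f'] Kf.
have [h Kh hE] := linear_ext_defect s0 lK sK Kf.
rewrite /scalar_rel /graph /=; apply/eqP; rewrite -subr_eq0.
apply/negPn/negP => /dnorm_Re_gt0 d0.
have := PK _ Kh; rewrite hE leNgt => /negP; apply.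
set d := complex.Re _ in d0 *.
have -> : complex.Im s * (- (4 * complex.Im s)^-1 * d) = - (d / 4) by field.
by rewrite oppr_lt0 divr_gt0.
Qed.

Lemma fixed_rel_eigen M s f f' : linear_relation M ->
  scale_rel (s ^+ 2) (inv_rel M) = M -> M (f, f') ->
  M (s *: f - f', (- s) *: (s *: f - f')).
Proof.
move=> lM fM Mf.
have Mf' : M (f', s ^+ 2 *: f).
  by rewrite -fM; exists (f', f) => //; exists (f, f').
have M0 : M (0, 0) by move: lM => [+ _]; rewrite inE.
(* The combination is [s (f, f') - (f', s^2 f)]; the pair [(0, 0)] only brings it to the form
   [a u + v]. *)
have := linear_relationP lM s Mf (linear_relationP lM (-1) Mf' M0).
congr (M _); apply/pair_equal_spec; rewrite /= !addr0 !scaleN1r; split=> //.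
by rewrite scalerBr !scaleNr opprK scalerA expr2 addrC.
Qed.

Lemma fixed_maximal_rel (P : set (V * V) -> Prop) s M : complex.Im s != 0 ->
  (forall K, P K <->
     forall h, K h -> 0 <= complex.Im s * complex.Im (dot h.2 h.1)) ->
  maximal_rel P M -> scale_rel (s ^+ 2) (inv_rel M) = M ->
  M = scalar_rel V s.
Proof.
move=> s0 PE [lM /PE PM maxM] fM; apply/esym/maxM.
- exact: linear_scalar_rel.
- by have [] := maximal_scalar_rel s0 PE.
(* On the pair [(d, - s d)] the condition reads [0 <= - (Im s)^2 * dot d d], which forces
   [d = 0]. *)
move=> [f f'] Mf; have := PM _ (fixed_rel_eigen lM fM Mf).
rewrite /= Im_dotZl raddfN /= mulNr mulrN oppr_ge0 mulrA leNgt => /negP h.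
rewrite /scalar_rel /graph /=; apply/eqP; rewrite eq_sym -subr_eq0.
apply/negPn/negP => /dnorm_Re_gt0 d0; apply: h.
by rewrite mulr_gt0 // -expr2 exprn_even_gt0.
Qed.

(* On the negative half-line positivity replaces dissipativity; there the
   surjectivity of [M + mu] takes over the role of maximality. *)
Lemma fixed_nonneg_rel (e s mu : R[i]) M (T : V -> V) : 0 < e * s ->
  s + mu != 0 -> linear_relation M -> (forall h, M h -> 0 <= e * dot h.2 h.1) ->
  inv_rel (shift_rel M mu) = graph T ->
  scale_rel (s ^+ 2) (inv_rel M) = M -> M = scalar_rel V s.
Proof.
move=> es0 smu0 lM pM TE fM.
have Ms f f' : M (f, f') -> f' = s *: f.
  move=> Mf; have := pM _ (fixed_rel_eigen lM fM Mf).
  rewrite /= linearZl_LR /= mulNr mulrN mulrA oppr_ge0 pmulr_rle0 // => d0.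
  apply/eqP; rewrite eq_sym -subr_eq0 -(dnorm_eq0 dot).
  by rewrite eq_le d0 dnorm_ge0.
apply/seteqP; split=> [[f f']|[f f']]; first exact: Ms.
rewrite /scalar_rel /graph /= => ->.
(* The vector [(s + mu) f] is in the range of [M + mu]. Its preimage [g] satisfies
   [(s + mu) g = (s + mu) f], so [g = f]. *)
have : graph T ((s + mu) *: f, T ((s + mu) *: f)) by [].
rewrite -TE => -[_ [[g g'] Mg <-] /= [gE _]].
have := Ms _ _ Mg => gE'; move: gE; rewrite gE' -scalerDl.
by move=> /(scalerI smu0) <-; rewrite -gE'.
Qed.

End LinearRelations.

(** * Topology and geometry of the cut plane *)

Section ComplexPlane.
Variable R : realType.
Implicit Types z : R[i].
Local Notation C := (R[i]^o : normedModType R[i]).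

Lemma normc_ge_Im z : `|complex.Im z|%:C%C <= `|z|.
Proof.
have := normc_ge_Re (z * 'i%C).
by rewrite ReiNIm normrN normrM (normCi _) mulr1.
Qed.

Lemma continuous_Re : continuous (@complex.Re R : C -> R).
Proof.
move=> z; apply/(@cvgrPdist_lt _ _ _ (nbhs (z : C))) => e e0.
have e0' : 0 < e%:C%C by rewrite ltcR.
have := @cvgr_dist_lt _ C _ _ (nbhs_filter (z : C)) id z cvg_id _ e0'.
apply: (@filterS _ _ (nbhs_filter (z : C))) => w; rewrite -raddfB /= -ltcR.
exact: le_lt_trans (normc_ge_Re _).
Qed.

Lemma continuous_Im : continuous (@complex.Im R : C -> R).
Proof.
move=> z; apply/(@cvgrPdist_lt _ _ _ (nbhs (z : C))) => e e0.
have e0' : 0 < e%:C%C by rewrite ltcR.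
have := @cvgr_dist_lt _ C _ _ (nbhs_filter (z : C)) id z cvg_id _ e0'.
apply: (@filterS _ _ (nbhs_filter (z : C))) => w; rewrite -raddfB /= -ltcR.
exact: le_lt_trans (normc_ge_Im _).
Qed.

Lemma continuous_real_complex : continuous (real_complex R : R -> C).
Proof.
move=> x; apply/cvgrPdist_lt => -[e e']; rewrite ltcE /= => /andP[/eqP -> e0].
near=> y; rewrite -rmorphB /= normc_def /= expr0n addr0 sqrtr_sqr ltcR.
near: y; exact: cvgr_dist_lt.
Unshelve. all: by end_near. Qed.

Lemma cut_planeE : @cut_plane R =
  [set z | complex.Re z < 0] `|` [set z | complex.Im z != 0].
Proof.
apply/seteqP; split=> z; rewrite /cut_plane /= lecE /= negb_and -ltNge.
  by rewrite eq_sym => /orP[]; [right|left].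
by rewrite eq_sym => -[->|->]; rewrite ?orbT.
Qed.

Lemma open_cut_plane : open (@cut_plane R : set R[i]^o).
Proof.
rewrite cut_planeE; apply: openU.
  exact: (@open_comp C R _ _ (fun z _ => @continuous_Re z) (@open_lt R 0)).
exact: (@open_comp C R _ _ (fun z _ => @continuous_Im z) (@open_neq R 0)).
Qed.

Lemma upper_half_cut_plane : @upper_half R `<=` @cut_plane R.
Proof.
by move=> z; rewrite cut_planeE => /gt_eqF Im0; right; rewrite /= Im0.
Qed.

Lemma lower_half_cut_plane : @lower_half R `<=` @cut_plane R.
Proof.
by move=> z; rewrite cut_planeE => /lt_eqF Im0; right; rewrite /= Im0.
Qed.

Lemma neg_axis_cut_plane : @neg_axis R `<=` @cut_plane R.
Proof. by move=> z; rewrite cut_planeE /neg_axis /= ltcE => /andP[_]; left. Qed.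

(** For [t > 0], either a nonzero imaginary part survives multiplication by [t], or the real part is
    a convex combination of two negative numbers. *)
Lemma cut_plane_star z (t : R) : cut_plane z -> 0 <= t <= 1 ->
  cut_plane (-1 + t%:C%C * (z + 1)).
Proof.
rewrite cut_planeE => zc /andP[t0 t1]; case: z zc => x y zc.
have -> : -1 + t%:C%C * ((x +i* y)%C + 1) = ((-1 + t * (x + 1)) +i* (t * y))%C.
  by apply/eqP; rewrite eq_complex /=; apply/andP; split; apply/eqP; ring.
have [->|tn0] := eqVneq t 0; first by left; rewrite /= mul0r addr0 ltrN10.
move: zc => /= zc.
have {}t0 : 0 < t by rewrite lt_neqAle eq_sym tn0.
case: zc => [x0|y0]; last by right; rewrite mulf_neq0.
by left => /=; nra.
Qed.

(** * Signs and symmetry of the square root branch *)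

Section Branch.
Variables (sq : R[i] -> R[i]) (hsq : is_sqrt_branch sq).

Lemma sqrt_branch_sqr z : cut_plane z -> sq z ^+ 2 = z.
Proof. by case: hsq => + _ _; exact. Qed.

Lemma sqrt_branch_derivable z : cut_plane z ->
  derivable (sq : R[i]^o -> R[i]^o) z 1.
Proof. by case: hsq => _ + _; exact. Qed.

(** A real square root would make [z] a nonnegative real. *)
Lemma sqrt_branch_Im_neq0 z : cut_plane z -> complex.Im (sq z) != 0.
Proof.
move=> zc; have := sqrt_branch_sqr zc; move: (zc) => /= /negP zN0 e.
apply/eqP => Im0; apply: zN0; rewrite -e.
case: (sq z) Im0 => x y /= ->.
by rewrite expr2 lecE /= !mulr0 mul0r addr0 eqxx subr0 -expr2 sqr_ge0.
Qed.

(* [Im sq] has no zero on the cut plane, which is star-shaped about [-1]. *)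
Lemma sqrt_branch_Im_gt0 z : cut_plane z -> 0 < complex.Im (sq z).
Proof.
move=> zc; pose p (t : R) : C := -1 + t%:C%C * (z + 1).
pose g (t : R) := complex.Im (sq (p t)).
have g0 : g 0 = 1 by rewrite /g /p mul0r addr0; case: hsq => _ _ ->.
have g1 : g 1 = complex.Im (sq z) by rewrite /g /p mul1r addrC addrK.
have gc : {within `[0, 1], continuous g}.
  apply: continuous_in_subspaceT => t; rewrite inE /= in_itv /= => t01.
  have pc : {for t, continuous p}.
    apply: (@continuousD _ C R (cst (-1)) (fun t => t%:C%C * (z + 1))).
      exact: cst_continuous.
    apply: (@continuousM R[i] R (real_complex R) (cst (z + 1))).
      exact: continuous_real_complex.
    exact: cst_continuous.
  apply: (@continuous_comp R C R p (fun w => complex.Im (sq w))) => //.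
  apply: (@continuous_comp C C R sq (@complex.Im R)); last exact: continuous_Im.
  apply: differentiable_continuous; apply/derivable1_diffP.
  exact/sqrt_branch_derivable/cut_plane_star.
(* Since [g 0 = 1], a nonpositive [g 1] would give a zero of [g] by the intermediate value
   theorem. *)
rewrite ltNge -g1; apply/negP => g1le0.
have [] := @IVT R g 0 1 0 ler01 gc.
  by rewrite g0 ge_min g1le0 orbT le_max ler01.
move=> t; rewrite in_itv /= => t01 gt.
by have := sqrt_branch_Im_neq0 (cut_plane_star zc t01);
   rewrite -/(p t) -/(g t) gt eqxx.
Qed.

(** Taking imaginary parts in [sq z ^+ 2 = z] gives [Im z = 2 Re (sq z) Im (sq z)], and
    [Im (sq z) > 0]. *)
Lemma sqrt_branch_Re_sign z : cut_plane z -> complex.Im z != 0 ->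
  0 < complex.Re (sq z) * complex.Im z.
Proof.
move=> zc; rewrite -{1 3}(sqrt_branch_sqr zc).
have := sqrt_branch_Im_gt0 zc.
case: (sq z) => x y /= y0.
have -> : x * y + y * x = 2 * x * y by ring.
rewrite !mulf_eq0 !negb_or => /andP[/andP[_ x0] _].
have -> : x * (2 * x * y) = x ^+ 2 * (2 * y) by ring.
by apply: mulr_gt0; [rewrite exprn_even_gt0|rewrite mulr_gt0].
Qed.

Lemma cut_plane_conj z : cut_plane z -> cut_plane (conjC z).
Proof.
by rewrite cut_planeE; case: z => x y /=; rewrite oppr_eq0.
Qed.

(** Both sides are square roots of [conjC z]; the other candidate, [conjC (sq z)], has negative
    imaginary part. *)
Lemma sqrt_branch_conj z : cut_plane z -> sq (conjC z) = - conjC (sq z).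
Proof.
move=> zc; have zc' := cut_plane_conj zc.
have /eqP : sq (conjC z) ^+ 2 = (- conjC (sq z)) ^+ 2.
  by rewrite sqrrN -rmorphXn /= !sqrt_branch_sqr.
rewrite eqf_sqr opprK => /orP[/eqP //|/eqP e].
have := sqrt_branch_Im_gt0 zc'; rewrite e.
have := sqrt_branch_Im_gt0 zc; case: (sq z) => x y /= y0.
by rewrite oppr_gt0 ltNge ltW.
Qed.

Lemma sqrt_branch_neq0 z : cut_plane z -> sq z != 0.
Proof.
move=> zc; apply/eqP => s0.
by have := sqrt_branch_Im_gt0 zc; rewrite s0 ltxx.
Qed.

(* The real part never vanishes, so [s z + mu] is invertible on the whole cut
   plane when [mu] is imaginary. *)
Definition nevanlinna_multiplier (s : R[i] -> R[i]) : Prop :=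
  [/\ forall z, complex.Im z != 0 -> 0 < complex.Im (s z) * complex.Im z,
      forall z, complex.Im z != 0 -> s (conjC z) = conjC (s z),
      forall z, cut_plane z -> complex.Re (s z) != 0 &
      forall z, cut_plane z -> derivable (s : C -> C) z 1].

Lemma cut_plane_Im z : complex.Im z != 0 -> cut_plane z.
Proof. by rewrite cut_planeE; right. Qed.

(** With [sq z = x + i y], the real part is [y / (x^2 + y^2)]. *)
Lemma Re_i_div_sqrt z : cut_plane z -> 0 < complex.Re ('i%C / sq z).
Proof.
move=> zc; have := sqrt_branch_Im_gt0 zc; case: (sq z) => x y /= y0.
rewrite mul0r mul1r sub0r ?mulNr opprK divr_gt0 //.
by rewrite ltr_wpDl ?sqr_ge0// exprn_gt0.
Qed.

Lemma Re_i_mul_sqrt z : cut_plane z -> complex.Re ('i%C * sq z) < 0.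
Proof.
move=> zc; have := sqrt_branch_Im_gt0 zc; case: (sq z) => x y /= y0.
by rewrite mul0r mul1r sub0r oppr_lt0.
Qed.

(** The imaginary part is [Re (sq z)] over a positive number, so it has the sign of [Im z]. In the
    conjugation identity the sign from [sq] cancels the one from conjugating [i]. *)
Lemma i_div_sqrt_multiplier : nevanlinna_multiplier (fun z => 'i%C / sq z).
Proof.
split=> [z z0|z z0|z zc|z zc].
- have zc := cut_plane_Im z0; have := sqrt_branch_Re_sign zc z0.
  have := sqrt_branch_Im_gt0 zc; case: (sq z) => x y /= y0 xz.
  rewrite !mul0r add0r mul1r mulrAC divr_gt0 //.
  by rewrite ltr_wpDl ?sqr_ge0// exprn_gt0.
- rewrite sqrt_branch_conj; last exact: cut_plane_Im.
  rewrite invrN mulrN -mulNr rmorphM fmorphV; congr (_ * _).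
  by apply/eqP; rewrite eq_complex /= oppr0 !eqxx.
- by rewrite gt_eqF // Re_i_div_sqrt.
- apply: (@derivableM R[i] C (cst 'i%C) (fun z => (sq z)^-1)) => //.
  by apply: (@derivableV R[i] C sq); [exact: sqrt_branch_neq0|
     exact: sqrt_branch_derivable].
Qed.

Lemma i_mul_sqrt_multiplier : nevanlinna_multiplier (fun z => 'i%C * sq z).
Proof.
split=> [z z0|z z0|z zc|z zc].
- have zc := cut_plane_Im z0; have := sqrt_branch_Re_sign zc z0.
  by case: (sq z) => x y /= xz; rewrite mul0r add0r mul1r.
- rewrite sqrt_branch_conj; last exact: cut_plane_Im.
  rewrite mulrN -mulNr rmorphM; congr (_ * _).
  by apply/eqP; rewrite eq_complex /= oppr0 !eqxx.
- by rewrite lt_eqF // Re_i_mul_sqrt.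
- apply: (@derivableM R[i] C (cst 'i%C) sq) => //.
  exact: sqrt_branch_derivable.
Qed.

End Branch.
End ComplexPlane.

(** * Families of scalar relations and uniqueness of the fixed point *)

Section Families.
Variables (R : realType) (V : completeNormedModType R[i]).
Variable dot : {dot V for conjC}.
Local Notation C := (R[i]^o : normedModType R[i]).
Variables (s : R[i] -> R[i]) (hs : nevanlinna_multiplier s).

Lemma multiplier_Im_neq0 z : complex.Im z != 0 -> complex.Im (s z) != 0.
Proof.
case: hs => sIm _ _ _ /sIm p; apply/eqP => s0.
by move: p; rewrite s0 mul0r ltxx.
Qed.

Lemma dissipative_multiplier z : upper_half z -> forall K,
  dissipative dot K <->
  forall h, K h -> 0 <= complex.Im (s z) * complex.Im (dot h.2 h.1).
Proof.
rewrite /upper_half /= => z0 K; case: hs => sIm _ _ _.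
have {}sIm : 0 < complex.Im (s z) by rewrite -(pmulr_lgt0 _ z0) sIm ?gt_eqF.
by split=> Kd h /Kd; rewrite pmulr_rge0.
Qed.

Lemma accumulative_multiplier z : lower_half z -> forall K,
  accumulative dot K <->
  forall h, K h -> 0 <= complex.Im (s z) * complex.Im (dot h.2 h.1).
Proof.
rewrite /lower_half /= => z0 K; case: hs => sIm _ _ _.
have {}sIm : complex.Im (s z) < 0 by rewrite -(nmulr_lgt0 _ z0) sIm ?lt_eqF.
by split=> Kd h /Kd; rewrite nmulr_rge0.
Qed.

Lemma bounded_scale (c : R[i]) : bounded_op ( *:%R c : V -> V).
Proof. by exists `|c| => x; rewrite normrZ. Qed.

(** The operator difference quotient at [x] is the scalar one times [x], so scalar convergence is
    automatically uniform on the unit ball. *)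
Lemma holomorphic_scale (U : set R[i]) (g : R[i] -> R[i]) :
  (forall z, U z -> derivable (g : C -> C) z 1) ->
  holomorphic_op_on U (fun z => *:%R (g z) : {linear V -> V}).
Proof.
move=> gd z /gd /cvg_ex[l gl]; exists ( *:%R l : {linear V -> V}).
  exact: bounded_scale.
move=> eps eps0; move/cvgrPdist_le : gl => /(_ _ eps0).
apply: filterS => h; rewrite /= scaler1 => hl x.
rewrite -scalerBl scalerA -scalerBl normrZ ler_wpM2r // distrC.
by rewrite [z + h]addrC.
Qed.

(** The whole cut plane serves as the open domain of the continuation, which is multiplication by
    [(s z + mu)^-1]. *)
Lemma resolvent_continues_scalar mu (A : set R[i]) : complex.Re mu = 0 ->
  A `<=` @cut_plane R ->
  resolvent_continues (fun z => scalar_rel V (s z)) mu A.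
Proof.
move=> mu0 Ac; case: hs => _ _ sRe sd.
have smu z : cut_plane z -> s z + mu != 0.
  move=> /sRe; apply: contra_neq => /(congr1 (@complex.Re R)).
  by rewrite raddfD /= mu0 addr0.
have Ac' : A `|` @neg_axis R `<=` @cut_plane R.
  by move=> z [/Ac//|/neg_axis_cut_plane].
exists (@cut_plane R), (fun z => *:%R (s z + mu)^-1 : {linear V -> V}); split.
- exact: open_cut_plane.
- exact: Ac'.
- by move=> z _; exact: bounded_scale.
- by move=> z /Ac' zc; rewrite resolvent_scalar_rel // smu.
- apply: holomorphic_scale => z zc.
  apply: (@derivableV R[i] C (fun z => s z + mu)); first exact: smu.
  by apply: (@derivableD R[i] C C s (cst mu)); [exact: sd|exact: derivable_cst].
Qed.

Lemma resolvent_continues_holomorphic (M : R[i] -> set (V * V)) mu A :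
  resolvent_continues M mu A -> holomorphic_resolvent M mu A.
Proof.
move=> [U [T [_ AU Tb TE Th]]]; exists T; split=> z Az.
- by apply/Tb/AU; left.
- by apply: TE; left.
- by apply/Th/AU; left.
Qed.

Lemma continues_scalar : continues_to_neg_axis (fun z => scalar_rel V (s z)).
Proof.
split; [exists 'i%C | exists (- 'i%C)] => /=.
- by rewrite /upper_half /= ltr01.
- exact: resolvent_continues_scalar (@upper_half_cut_plane R).
- by rewrite /lower_half /= ltrN10.
- by apply: resolvent_continues_scalar; [rewrite /= oppr0|
    exact: lower_half_cut_plane].
Qed.

Lemma nevanlinna_scalar : nevanlinna_family dot (fun z => scalar_rel V (s z)).
Proof.
split.
- split=> z zh; apply: maximal_scalar_rel.
  + by apply: multiplier_Im_neq0; rewrite gt_eqF.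
  + exact: dissipative_multiplier.
  + by apply: multiplier_Im_neq0; rewrite lt_eqF.
  + exact: accumulative_multiplier.
- by move=> z z0; rewrite adj_scalar_rel; case: hs => _ -> //.
- have [[mu mu0 /resolvent_continues_holomorphic h]
    [nu nu0 /resolvent_continues_holomorphic k]] := continues_scalar.
  by split; [exists mu|exists nu].
Qed.

(* [e = 1] gives the Stieltjes families, [e = -1] the inverse ones. *)
Definition signed_stieltjes_family (e : R) (M : R[i] -> set (V * V)) : Prop :=
  [/\ nevanlinna_family dot M,
      forall x, neg_axis x ->
        linear_relation (M x) /\
        (forall h, M x h -> 0 <= e%:C%C * dot h.2 h.1) &
      continues_to_neg_axis M].

(** Both mappings invert and then multiply by a scalar [c z], equal to [- z^-1] or [- z]; this
    covers both at once. *)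
Lemma unique_fixed_point_scalar (e : R) (c : R[i] -> R[i]) :
  (forall z, neg_axis z -> 0 < e%:C%C * s z) ->
  (forall z, cut_plane z -> c z = s z ^+ 2) ->
  unique_fixed_point (signed_stieltjes_family e)
    (fun M z => scale_rel (c z) (inv_rel (M z))) (fun z => scalar_rel V (s z)).
Proof.
move=> es cE; split.
- split; [exact: nevanlinna_scalar| |exact: continues_scalar].
  move=> x /es x0; split; first exact: linear_scalar_rel.
  move=> [f f']; rewrite /scalar_rel /graph /= => ->.
  by rewrite linearZl_LR /= mulrA mulr_ge0 ?dnorm_ge0 // ltW.
- move=> z; rewrite inE => zc; apply: Phi_scalar_rel; last exact: cE.
  by case: hs => _ _ /(_ _ zc) sRe _; apply: contra_neq sRe => ->.
- move=> M [[[Mu Ml] _ _] Mx [[mu mu0 [U [T [_ _ _ TE _]]]] _]] fM z.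
  rewrite inE => zc; have := fM z; rewrite inE cE // => /(_ zc) {}fM.
  (* Maximality settles the two half-planes; a point of the cut plane with zero imaginary part lies
     on the negative half-line, where sign and resolvent are used. *)
  have [z0|z0|z0] := ltgtP 0 (complex.Im z).
  + apply: (fixed_maximal_rel _ (dissipative_multiplier z0)) (Mu _ z0) fM.
    by rewrite multiplier_Im_neq0 ?gt_eqF.
  + apply: (fixed_maximal_rel _ (accumulative_multiplier z0)) (Ml _ z0) fM.
    by rewrite multiplier_Im_neq0 ?lt_eqF.
  + have zn : neg_axis z.
      rewrite /neg_axis /= ltcE /= z0 eqxx /=.
      by move: zc; rewrite cut_planeE /= -z0 eqxx => -[].
    have [lM pM] := Mx _ zn.
    (* Since [0 < e * s z] with [e] real, [s z] is real, whereas [- mu] is not. *)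
    have smu : s z + mu != 0.
      apply: contraTneq (es _ zn) => /eqP; rewrite addr_eq0 => /eqP ->.
      rewrite ltcE; case: mu mu0 TE => p q; rewrite /upper_half /= => q0 _.
      have [->|e0] := eqVneq e 0; first by rewrite !mul0r subr0 ltxx andbF.
      by rewrite mul0r addr0 mulf_eq0 (negPf e0) oppr_eq0 (gt_eqF q0).
    by apply: (fixed_nonneg_rel (es _ zn) smu lM pM (TE _ (or_intror zn)) fM).
Qed.

End Families.

(** * The two classes, the signs on the negative half-line, and the conclusion *)

Lemma stieltjes_familyE (R : realType) (V : completeNormedModType R[i])
    (dot : {dot V for conjC}) :
  stieltjes_family dot = signed_stieltjes_family dot 1.
Proof.
apply/funext => M; apply/propext.
by split=> -[? h ?]; split=> // x /h [lM p]; split=> // k /p; rewrite mul1r.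
Qed.

Lemma inv_stieltjes_familyE (R : realType) (V : completeNormedModType R[i])
    (dot : {dot V for conjC}) :
  inv_stieltjes_family dot = signed_stieltjes_family dot (-1).
Proof.
have e (k : V * V) : dot (-1 *: k.2) k.1 = (-1)%:C%C * dot k.2 k.1.
  by rewrite linearZl_LR /= rmorphN1.
apply/funext => M; apply/propext.
split=> -[? h ?]; split=> // x /h [lM p]; split=> // k Mk.
  by rewrite -e; apply: (p (k.1, -1 *: k.2)); exists k.
by move: Mk => [l /p + <-] /=; rewrite e.
Qed.

(** A positive square has [2 Re w Im w = 0], so [Re w > 0] makes [w] real. On the negative half-line
    this applies to [i / sq z] and [- i * sq z], whose squares are [- z^-1] and [- z]. *)
Lemma complex_gt0_sqr (R : realType) (w : R[i]) :
  0 < complex.Re w -> 0 < w ^+ 2 -> 0 < w.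
Proof.
case: w => x y /= x0; rewrite expr2 !ltcE /= x0 andbT => /andP[+ _].
by rewrite [y * x]mulrC -mulr2n mulrn_eq0 /= mulf_eq0 (gt_eqF x0).
Qed.

Lemma i_div_sqrt_neg_axis (R : realType) (sq : R[i] -> R[i]) z :
  is_sqrt_branch sq -> neg_axis z -> 0 < 'i%C / sq z.
Proof.
move=> hsq zn; have zc := neg_axis_cut_plane zn.
apply: complex_gt0_sqr; first exact: Re_i_div_sqrt.
by rewrite expr_div_n sqrt_branch_sqr // sqr_i mulN1r oppr_gt0 invr_lt0.
Qed.

Lemma i_mul_sqrt_neg_axis (R : realType) (sq : R[i] -> R[i]) z :
  is_sqrt_branch sq -> neg_axis z -> 'i%C * sq z < 0.
Proof.
move=> hsq zn; have zc := neg_axis_cut_plane zn.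
rewrite -oppr_gt0; apply: complex_gt0_sqr.
  by rewrite raddfN oppr_gt0 Re_i_mul_sqrt.
by rewrite sqrrN exprMn sqrt_branch_sqr // sqr_i mulN1r oppr_gt0.
Qed.

Theorem proposition4p7 (R : realType) (V : completeNormedModType R[i])
    (dot : {dot V for conjC}) (hdot : is_hilbert_dot dot)
    (hsep : is_separable V)
    (sq : R[i] -> R[i]) (hsq : is_sqrt_branch sq) :
  (unique_fixed_point (stieltjes_family dot) (@Phi_plus R V)
     (fun z : R[i] => scalar_rel V ('i%C / sq z)) /\
   scalar_rel V ('i%C / sq (-1)) = graph (fun x : V => x)) /\
  (unique_fixed_point (inv_stieltjes_family dot) (@Phi_minus R V)
     (fun z : R[i] => scalar_rel V ('i%C * sq z)) /\
   scalar_rel V ('i%C * sq (-1)) = graph (fun x : V => - x)).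
Proof.
have sqN1 : sq (-1) = 'i%C by case: hsq.
split; split.
- rewrite stieltjes_familyE; apply: unique_fixed_point_scalar.
  + exact: i_div_sqrt_multiplier.
  + by move=> z /(i_div_sqrt_neg_axis hsq); rewrite mul1r.
  + by move=> z zc; rewrite expr_div_n sqrt_branch_sqr // sqr_i mulN1r.
- rewrite sqN1 divff ?neq0Ci //.
  by apply/seteqP; split=> -[f f']; rewrite /scalar_rel /graph /= scale1r.
- rewrite inv_stieltjes_familyE; apply: unique_fixed_point_scalar.
  + exact: i_mul_sqrt_multiplier.
  + move=> z /(i_mul_sqrt_neg_axis hsq).
    by rewrite rmorphN1 mulN1r oppr_gt0.
  + by move=> z zc; rewrite exprMn sqrt_branch_sqr // sqr_i mulN1r.
- rewrite sqN1 -expr2 sqr_i.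
  by apply/seteqP; split=> -[f f']; rewrite /scalar_rel /graph /= scaleN1r.
Qed.
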